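(* Let $R>0$ and $\xi$ be the length and the increment of a generic cycle of a process with regenerative increments, with $\mathbb{E}R<\infty$. Let $F(x)=\mathbb{P}(\xi\le x)$, $x\ge0$, be a discrete subexponential distribution with point probabilities $f_0,f_1,\ldots$ (on $\{0,1,2,\dots\}$), and let $\varphi$ be a function with $\varphi(x)/e(x)\to\infty$ as $x\to\infty$. Assume that for some $\varepsilon,\delta>0$, $$\mathbb{P}\bigl(R>\varepsilon\varphi(x)\,\big|\,\xi>x\bigr)\ge\delta\quad\text{for all large }x.$$ Then there is a constant $c<\infty$ such that $\varphi(x)\le c/\overline F(x)$ for all sufficiently large $x$.
   Context: Process with regenerative increments: $\{Z(t)\}_{t\ge 0}$, $Z(0)=0$, with random times $0=T_0<T_1<\cdots$ such that, with $R_k=T_k-T_{k-1}$, the cycles $\bigl(R_{k+1},\{Z(t+T_k)-Z(T_k)\}_{0\le t\le R_{k+1}}\bigr)$, $k\ge0$, are i.i.d.; $(R,\xi)$ is distributed as $(T_1,Z(T_1))$. $\overline F=1-F$. The function $e(x)\uparrow\infty$ (positive, nondecreasing, tending to $\infty$) is a scaling function of $F$, i.e. for every $t>0$, $\overline{F^I}(x+te(x))/\overline{F^I}(x)\to\overline G(t)$ as $x\to\infty$ for some probability distribution $G$ on $[0,\infty)$, where $\overline{F^I}(x)=\min\bigl(1,\int_x^\infty\overline F(y)\,dy\bigr)$. A distribution $F$ on $[0,\infty)$ is subexponential if $\overline F(x)>0$ for all $x$ and $\overline{F*F}(x)\sim2\overline F(x)$ as $x\to\infty$. *)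

(* Defs.v *)
From HB Require Import structures.
From mathcomp Require Import all_boot all_order all_algebra.
From mathcomp Require Import all_classical all_reals all_analysis.

Set Implicit Arguments.
Unset Strict Implicit.
Unset Printing Implicit Defensive.
Import Order.TTheory GRing.Theory Num.Theory.
Import numFieldNormedType.Exports.
Local Open Scope classical_set_scope.
Local Open Scope ring_scope.

Definition mutually_independent {d d'} {T : measurableType d}
    {S : measurableType d'} {R : realType} (P : probability T R)
    (X : nat -> T -> S) : Prop :=
  forall (J : seq nat) (A : nat -> set S), uniq J ->
    (forall k, k \in J -> measurable (A k)) ->
    P (\bigcap_(k in [set` J]) (X k @^-1` A k))
    = (\prod_(k <- J) P (X k @^-1` A k))%E.

Definition equal_law {d1 d2 d'} {T1 : measurableType d1}
    {T2 : measurableType d2} {S : measurableType d'} {R : realType}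
    (P1 : probability T1 R) (X1 : T1 -> S)
    (P2 : probability T2 R) (X2 : T2 -> S) : Prop :=
  forall A, measurable A -> P1 (X1 @^-1` A) = P2 (X2 @^-1` A).

Definition iid {d d'} {T : measurableType d} {S : measurableType d'}
    {R : realType} (P : probability T R) (X : nat -> T -> S) : Prop :=
  [/\ forall k, measurable_fun [set: T] (X k),
      forall k, equal_law P (X k) P (X 0%N) &
      mutually_independent P X].

(* A cycle (r, {y(t)}_{0 <= t <= r}) is encoded by its length r together with
   the path on the whole half-line that equals y on [0, r] and stays at y(r)
   afterwards; coordinates at negative times are not observed.  Its
   sigma-algebra is generated by the length and all coordinates at t >= 0. *)
Definition cycle_generator (R : realType) : set (set (R * (R -> R))) :=
  [set A | exists2 B : set R, measurable B & A = [set c | B c.1]]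
  `|` [set A | exists t : R, 0 <= t /\
        exists2 B : set R, measurable B & A = [set c | B (c.2 t)]].

Definition cycle_space (R : realType) :=
  g_sigma_algebraType (@cycle_generator R).

Definition regeneration_cycle {R : realType} {T : Type} (Z : R -> T -> R)
    (tau : nat -> T -> R) (k : nat) (w : T) : cycle_space R :=
  let r := tau k.+1 w - tau k w in
  (r, fun t => Z (tau k w + Num.min t r) w - Z (tau k w) w).

(* Only the values Z t with t >= 0 matter. *)
Definition regenerative_increments {d} {T : measurableType d} {R : realType}
    (P : probability T R) (Z : R -> T -> R) (tau : nat -> T -> R) : Prop :=
  [/\ forall t, 0 <= t -> measurable_fun [set: T] (Z t),
      forall w, Z 0 w = 0,
      forall w, tau 0%N w = 0,
      forall k w, tau k w < tau k.+1 w &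
      iid P (regeneration_cycle Z tau)].

Section distributions.
Context {R : realType}.
Implicit Types F : probability R R.

Definition on_halfline F : Prop := F `]-oo, 0[%classic = 0%E.

Definition tail F (x : R) : R := fine (F `]x, +oo[%classic).

Definition conv_tail F (x : R) : R := fine ((F \x F)%E [set p | x < p.1 + p.2]).

Definition subexponential F : Prop :=
  [/\ on_halfline F,
      forall x, 0 < tail F x &
      conv_tail F x / tail F x @[x --> +oo] --> (2 : R)].

Definition point_probabilities F (f : nat -> R) : Prop :=
  (forall n, F [set n%:R] = (f n)%:E) /\ F (range (fun n : nat => n%:R)) = 1%E.

Definition integrated_tail F (x : R) : R :=
  fine (mine 1%E (\int[lebesgue_measure]_(y in `[x, +oo[) (tail F y)%:E)%E).

Definition scaling_function F (e : R -> R) : Prop :=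
  [/\ forall x, 0 <= x -> 0 < e x,
      forall x y, 0 <= x -> x <= y -> e x <= e y,
      e x @[x --> +oo] --> +oo &
      exists2 G : probability R R, on_halfline G &
        forall t, 0 < t ->
          integrated_tail F (x + t * e x) / integrated_tail F x @[x --> +oo]
            --> tail G t].

End distributions.

Definition cond_prob {d} {T : measurableType d} {R : realType}
    (P : probability T R) (A B : set T) : R :=
  fine (P (A `&` B)) / fine (P B).

(* Main.v *)
Require Import Defs.
From HB Require Import structures.
From mathcomp Require Import all_boot all_order all_algebra.
From mathcomp Require Import all_classical all_reals all_analysis.
From mathcomp Require Import measurable_realfun ring.

(** Conditioning on a large increment forces a long cycle, and long cycles are
    rare because they have a finite mean. Indeed, for large [x],
      [delta * P(xi > x) <= P(R > eps * phi x, xi > x) <= P(R > eps * phi x)],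
    and Markov's inequality bounds the last probability by
    [E R / (eps * phi x)] as soon as [phi x > 0]. Since [P(xi > x)] is the tail
    of [F] at [x] ([tail_of_cdf]), this is the claim with
    [c = E R / (eps * delta)]; as [c >= 0], the claim is trivial where
    [phi x <= 0]. *)

Set Implicit Arguments.
Unset Strict Implicit.
Unset Printing Implicit Defensive.
Import Order.TTheory GRing.Theory Num.Theory.
Import numFieldNormedType.Exports.
Local Open Scope classical_set_scope.
Local Open Scope ring_scope.

Lemma measurable_gtRV {d} {T : measurableType d} {K : realType}
    (P : probability T K) (X : {RV P >-> K}) (a : K) :
  measurable [set w | a < X w].
Proof.
by rewrite -preimage_itvoy -[X in measurable X]setTI; exact: measurable_funPT.
Qed.

Lemma ae_eq_normr {d} {T : measurableType d} {K : realType}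
    (P : probability T K) (X : {RV P >-> K}) :
  {ae P, forall w, 0 < X w} -> 'E_P[X]%E = 'E_P[fun w => `|X w|%R]%E.
Proof.
move=> X0; rewrite unlock; apply: ae_eq_integral => //.
- exact/measurable_EFinP.
- by apply/measurable_EFinP; exact: measurableT_comp.
- by apply: filterS X0 => w Xw _ /=; rewrite gtr0_norm.
Qed.

(** Markov's inequality bounds the tail of [`|X|] by its mean; almost sure
    positivity lets [X] replace [`|X|] in the mean, and [X <= `|X|] pointwise
    handles the event. *)
Lemma markov_ae_pos {d} {T : measurableType d} {K : realType}
    (P : probability T K) (X : {RV P >-> K}) (a : K) :
  {ae P, forall w, 0 < X w} -> 0 < a ->
  (a%:E * P [set w | a < X w]%R <= 'E_P[X])%E.
Proof.
move=> X0 a0; rewrite (ae_eq_normr X0).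
have := @markov _ _ _ P X id a a0 (@measurable_id _ _ _) (fun r h => h)
  (fun x y _ _ h => h).
apply: le_trans; rewrite lee_pmul2l//; apply: le_measure.
- by rewrite inE; exact: measurable_gtRV.
- rewrite inE -[X in measurable X]setTI; apply: measurable_lee => //.
  by apply: measurableT_comp => //; exact/measurable_EFinP.
- by move=> w /= aX; rewrite lee_fin; exact: le_trans (ltW aX) (ler_norm _).
Qed.

Lemma tail_of_cdf {d} {T : measurableType d} {K : realType}
    (P : probability T K) (X : {RV P >-> K}) (F : probability K K) (x : K) :
  F `]-oo, x]%classic = P [set w | X w <= x] ->
  tail F x = fine (P [set w | x < X w]).
Proof.
move=> Fx; have mX : measurable [set w | X w <= x].
  rewrite -[X in measurable X]setTI.
  by apply: measurable_fun_le => //; exact: measurable_funPT.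
have -> : [set w | x < X w] = ~` [set w | X w <= x].
  by apply/seteqP; split=> w /=; rewrite ltNge => /negP.
by rewrite /tail -setCitvl !probability_setC// Fx.
Qed.

Theorem theorem7p3 (K : realType)
  (d : measure_display) (Omega : measurableType d) (P : probability Omega K)
  (Z : K -> Omega -> K) (tau : nat -> Omega -> K)
  (hZ : regenerative_increments P Z tau)
  (d' : measure_display) (Omega' : measurableType d') (Q : probability Omega' K)
  (R xi : {RV Q >-> K})
  (hRxi : equal_law Q (fun w => (R w, xi w)) P (fun w => (tau 1%N w, Z (tau 1%N w) w)))
  (hR0 : {ae Q, forall w, 0 < R w})
  (hR1 : ('E_Q[R] < +oo)%E)
  (F : probability K K) (f : nat -> K)
  (hF : forall x : K, 0 <= x -> F `]-oo, x]%classic = Q [set w | xi w <= x])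
  (hFsub : subexponential F)
  (hFdisc : point_probabilities F f)
  (e : K -> K) (he : scaling_function F e)
  (phi : K -> K) (hphi : phi x / e x @[x --> +oo] --> +oo)
  (eps delta : K) (heps : 0 < eps) (hdelta : 0 < delta)
  (hcond : \forall x \near +oo,
     delta <= cond_prob Q [set w | eps * phi x < R w] [set w | x < xi w]) :
  exists c : K, \forall x \near +oo, phi x <= c / tail F x.
Proof.
have ER0 : (0 <= 'E_Q[R])%E.
  by rewrite (ae_eq_normr hR0); apply: expectation_ge0 => w /=.
have ERE : ('E_Q[R] = (fine 'E_Q[R]%E)%:E)%E by rewrite fineK// ge0_fin_numE.
have tail0 : forall x, 0 < tail F x by case: hFsub.
have mR a := measurable_gtRV R a.
have mxi a := measurable_gtRV xi a.
exists (fine 'E_Q[R]%E / (eps * delta)).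
near=> x.
have x0 : 0 <= x by near: x; exact: nbhs_pinfty_ge.
have [phi0|phi0] := leP (phi x) 0.
  apply: (le_trans phi0); rewrite !divr_ge0 ?mulr_ge0 ?fine_ge0//;
  exact: ltW.
have tailE := tail_of_cdf (hF x x0).
have : delta <= cond_prob Q [set w | eps * phi x < R w] [set w | x < xi w].
  by near: x.
rewrite /cond_prob -tailE ler_pdivlMr// => joint.
have long : delta * tail F x <= fine (Q [set w | eps * phi x < R w]).
  apply: (le_trans joint); rewrite fine_le ?fin_num_measure//.
    exact: measurableI.
  by rewrite le_measure ?inE//; exact: measurableI.
have := markov_ae_pos hR0 (mulr_gt0 heps phi0).
rewrite -[Q _]fineK ?fin_num_measure// ERE -EFinM lee_fin => mean.
rewrite ler_pdivlMr// ler_pdivlMr ?mulr_gt0//; apply: le_trans mean.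
have -> : phi x * tail F x * (eps * delta) =
  eps * phi x * (delta * tail F x) by ring.
by rewrite ler_wpM2l// ltW// mulr_gt0.
Unshelve. all: by end_near.
Qed.
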